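(* Let $k$ be a positive integer, $m=2k+2$, and $d\in\{2,3\}$. For $c\in\mathbb{F}_2^k$ and $\alpha\in\mathbb{F}_2^d$ let $S_{c,\alpha}$ be the set of $(1,-1)$-sequences of length $2^m$ defined in the context. Then: (i) For all $c\in\mathbb{F}_2^k$ and $\alpha\in\mathbb{F}_2^d$, all the sequences in $S_{c,\alpha}$ are semi-bent sequences. (ii) For any $c\in\mathbb{F}_2^k$, $\alpha\in\mathbb{F}_2^d$, $S_{c,\alpha}$ is a set of orthogonal sequences with $\#S_{c,\alpha}=2^{m-d}$. (iii) Let $c\in\mathbb{F}_2^k$ and $\alpha=(\alpha_1,\dots,\alpha_d)\in\mathbb{F}_2^d$. For any fixed $e\in\mathbb{F}_2^k$ with $e\neq c$ and any fixed $\delta=(\delta_1,\dots,\delta_d)\in\mathbb{F}_2^d$, $S_{c,\alpha}\perp S_{e,\delta}$ if and only if $(\alpha_{d-1},\alpha_d)\neq(\delta_{d-1},\delta_d)$. In addition, $S_{e,\alpha}\perp S_{e,\delta}$ if and only if $\alpha\neq\delta$. (iv) For any fixed $e\in\mathbb{F}_2^k$, $\delta\in\mathbb{F}_2^d$, there exist $3\cdot 2^{k+d-2}+2^{d-2}-1$ many sets in $\Omega=\{S_{c,\alpha}\mid c\in\mathbb{F}_2^k,\ \alpha\in\mathbb{F}_2^d\}$ that are orthogonal to $S_{e,\delta}$.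
   Context: Boolean functions and sequences. $\mathcal{B}_m$ denotes the set of functions $f:\mathbb{F}_2^m\to\mathbb{F}_2$. For $a,b\in\mathbb{F}_2^n$, $a\cdot b=\sum_i a_ib_i\in\mathbb{F}_2$. The Walsh–Hadamard transform of $f\in\mathcal{B}_m$ is $W_f(\omega)=\sum_{x\in\mathbb{F}_2^m}(-1)^{f(x)+\omega\cdot x}$. The function $f$ is semi-bent if $W_f(\omega)\in\{0,\pm 2^{\lambda}\}$ for all $\omega\in\mathbb{F}_2^m$, with $\lambda=\lfloor (m+2)/2\rfloor$. The sequence of $f\in\mathcal{B}_m$ is the $(1,-1)$-sequence $\overline{f}=((-1)^{f(x)})_{x\in\mathbb{F}_2^m}$ of length $2^m$; it is a semi-bent sequence if $f$ is semi-bent. Sequences $\overline{f_1},\overline{f_2}$ are orthogonal if $\sum_{x}(-1)^{f_1(x)+f_2(x)}=0$ (as an integer). A set of orthogonal sequences is a set of pairwise orthogonal sequences. For two sets of orthogonal sequences, $S_1\perp S_2$ (''$S_1$ is orthogonal to $S_2$'') means that every sequence of $S_1$ is orthogonal to every sequence of $S_2$. Componentwise product: $\overline{f_1}*\overline{f_2}=\overline{f_1+f_2}$. Construction. Let $\gamma$ be a primitive element of $\mathbb{F}_{2^k}$ and let $\pi:\mathbb{F}_{2^k}\to\mathbb{F}_2^k$ be the linear isomorphism $\pi(b_1+b_2\gamma+\cdots+b_k\gamma^{k-1})=(b_1,\dots,b_k)$. For $y\in\mathbb{F}_2^k$ let $[y]=\sum_{j=1}^k y_j2^{j-1}$ (an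 integer). For $i=1,\dots,k$ define $\phi_i:\mathbb{F}_2^k\to\mathbb{F}_2^k$ by $\phi_i(\mathbf{0})=\mathbf{0}$ and $\phi_i(y)=\pi(\gamma^{[y]+i})$ for $y\neq\mathbf{0}$. For $y\in\mathbb{F}_2^k$, $x\in\mathbb{F}_2^{k+2}$ let $f_i(y,x)=(\phi_i(y),0,0)\cdot x$, where $(\phi_i(y),0,0)\in\mathbb{F}_2^{k+2}$. For $c\in\mathbb{F}_2^k$ let $f_c=c_1f_1+\cdots+c_kf_k$, a function of $(y,x)\in\mathbb{F}_2^m$. For $\alpha\in\mathbb{F}_2^d$ let $L_\alpha=\{\,l_\beta(y,x)=(\beta,\alpha)\cdot(y,x)\mid\beta\in\mathbb{F}_2^{m-d}\}$, where $(\beta,\alpha)\in\mathbb{F}_2^m$ is the concatenation (so $\alpha$ occupies the last $d$ coordinates). Define $$S_{c,\alpha}=\{\overline{f_c}*\overline{l}\mid l\in L_\alpha\},\qquad c\in\mathbb{F}_2^k,\ \alpha\in\mathbb{F}_2^d.$$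
   Formalization: Part (i) is stated only for c ≠ 0: for c = 0 we have f_0 = 0, so S_{0,α} consists of sequences of linear functions, whose Walsh–Hadamard transform takes the value 2^m = 2^{2k+2}, not in {0, ±2^{k+2}}; so the claim fails there. *)

(* Defs.v *)
From HB Require Import structures.
From mathcomp Require Import all_boot all_order all_algebra all_field finmap.

Set Implicit Arguments.
Unset Strict Implicit.
Unset Printing Implicit Defensive.

Import GRing.Theory.
Local Open Scope fset_scope.
Local Open Scope ring_scope.

(* Boolean functions on F_2^n. *)
Notation bfun n := {ffun 'rV['F_2]_n -> 'F_2}.

(* Integer sequences of length 2^n, with terms indexed by F_2^n. *)
Notation intseq n := {ffun 'rV['F_2]_n -> int}.

Definition dot n (a b : 'rV['F_2]_n) : 'F_2 := \sum_(i < n) a 0 i * b 0 i.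

Definition walsh n (f : bfun n) (w : 'rV['F_2]_n) : int :=
  \sum_(x : 'rV['F_2]_n) (-1) ^+ nat_of_ord (f x + dot w x).

Definition semibent n (f : bfun n) : Prop :=
  let lambda := ((n + 2) %/ 2)%N in
  forall w, walsh f w \in [:: 0; 2 ^+ lambda; - 2 ^+ lambda].

Definition seq_of n (f : bfun n) : intseq n :=
  [ffun x => (-1) ^+ nat_of_ord (f x)].

Definition semibent_seq n (s : intseq n) : Prop :=
  exists2 f : bfun n, s = seq_of f & semibent f.

Definition seq_mul n (s t : intseq n) : intseq n := [ffun x => s x * t x].

(* If s = seq_of f and t = seq_of g, the summand is (-1)^(f x + g x). *)
Definition orthogonal_seq n (s t : intseq n) : bool :=
  \sum_(x : 'rV['F_2]_n) seq_mul s t x == 0.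

Definition orthogonal_set n (S : {fset intseq n}) : Prop :=
  forall s t, s \in S -> t \in S -> s != t -> orthogonal_seq s t.

Definition perp n (S T : {fset intseq n}) : bool :=
  [forall s : S, forall t : T, orthogonal_seq (val s) (val t)].

(* The j-th coordinate of v, with j counted from 1 (0 when out of range). *)
Definition entry n (v : 'rV['F_2]_n) (j : nat) : 'F_2 :=
  if insub j.-1 is Some i then v 0 i else 0.

Section Construction.

(* F is F_(2^k) when \dim {:F} = k. *)
Variables (F : fieldExtType 'F_2) (gamma : F) (k : nat).

(* Coordinates in (1, gamma, ..., gamma^(k-1)), which is a basis of F_(2^k)  *)
(* when gamma is primitive.                                                  *)
Definition pi_ (z : F) : 'rV['F_2]_k :=
  \row_(j < k) coord [tuple gamma ^+ i | i < k] j z.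

Definition intval (y : 'rV['F_2]_k) : nat :=
  (\sum_(j < k) nat_of_ord (y ord0 j) * 2 ^ j)%N.

(* The index i : 'I_k is counted from 0, hence the shift of the exponent. *)
Definition phi (i : 'I_k) (y : 'rV['F_2]_k) : 'rV['F_2]_k :=
  if y == 0 then 0 else pi_ (gamma ^+ (intval y + i.+1)).

(* The number of variables m = 2k + 2, in a form that splits z as (y, x). *)
Definition nvars : nat := (k + (k + 2))%N.

Definition f_ (i : 'I_k) : bfun nvars :=
  [ffun z : 'rV['F_2]_(k + (k + 2)) =>
     dot (row_mx (phi i (lsubmx z)) (0 : 'rV_2)) (rsubmx z)].

Definition fcomb (c : 'rV['F_2]_k) : bfun nvars :=
  [ffun z => \sum_(i < k) c 0 i * f_ i z].

Variable d : nat.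

(* (beta, alpha); for d <= nvars the dimensions (nvars - d) + d and nvars    *)
(* agree, so that conform_mx is only a transport between equal dimensions.   *)
Definition concat (beta : 'rV['F_2]_(nvars - d)) (alpha : 'rV['F_2]_d) :
    'rV['F_2]_nvars :=
  conform_mx 0 (row_mx beta alpha).

Definition linf (beta : 'rV['F_2]_(nvars - d)) (alpha : 'rV['F_2]_d) :
    bfun nvars :=
  [ffun z => dot (concat beta alpha) z].

Definition Lset (alpha : 'rV['F_2]_d) : {set bfun nvars} :=
  [set linf beta alpha | beta : 'rV['F_2]_(nvars - d)].

Definition Sset (c : 'rV['F_2]_k) (alpha : 'rV['F_2]_d) : {fset intseq nvars} :=
  [fset seq_mul (seq_of (fcomb c)) (seq_of l) | l in Lset alpha].

Definition Omega : {fset {fset intseq nvars}} :=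
  [fset Sset p.1 p.2 | p : 'rV['F_2]_k * 'rV['F_2]_d].

End Construction.

(* Main.v *)
(* For nonzero c, the map y |-> sum_i c_i phi_i(y) is injective: at y != 0 it is
   pi(gamma^[y] (sum_i c_i gamma^i)), the integers [y] run over 1, ..., 2^k - 1,
   and gamma, ..., gamma^k are linearly independent because gamma has too many
   distinct powers to lie in a proper subfield. Summing over x first, the Walsh
   transform of f_c at w is then +-2^(k+2) if the last two coordinates of w
   vanish, and 0 otherwise; for c = 0 it is 2^m at w = 0 and 0 elsewhere. The
   inner product of the sequences of f_c + w.z and f_e + w'.z is the Walsh
   transform of f_(c-e) at w - w', so every claim can be read off from it. In
   particular it never has the value 2^m for c != e, hence distinct (c, alpha)
   give distinct sets, and the last claim amounts to counting pairs. *)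
Require Import Defs.
From HB Require Import structures.
From mathcomp Require Import all_boot all_order all_algebra all_field finmap zify.

Set Implicit Arguments.
Unset Strict Implicit.
Unset Printing Implicit Defensive.

Import GRing.Theory.
Local Open Scope fset_scope.
Local Open Scope ring_scope.

(** * Signs, dot products and character sums over F_2^n *)

Lemma signF2D (x y : 'F_2) :
  (-1) ^+ nat_of_ord (x + y) = (-1) ^+ nat_of_ord x * (-1) ^+ nat_of_ord y :> int.
Proof. by case: x y => [[|[|x]] hx] [[|[|y]] hy]. Qed.

Lemma signF2N (x : 'F_2) :
  (-1) ^+ nat_of_ord (- x) = (-1) ^+ nat_of_ord x :> int.
Proof. by case: x => [[|[|x]] hx]. Qed.

Lemma nonzeroF2 (x : 'F_2) : x != 0 -> x = 1.
Proof. by case: x => [[|[|x]] hx] // _; apply/val_inj. Qed.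

Lemma dot0l n (x : 'rV['F_2]_n) : dot 0 x = 0.
Proof. by rewrite /dot big1 // => i _; rewrite mxE mul0r. Qed.

Lemma dotDl n (v w x : 'rV['F_2]_n) : dot (v + w) x = dot v x + dot w x.
Proof. by rewrite -big_split; apply: eq_bigr => i _; rewrite mxE mulrDl. Qed.

Lemma dotNl n (v x : 'rV['F_2]_n) : dot (- v) x = - dot v x.
Proof. by rewrite -sumrN; apply: eq_bigr => i _; rewrite mxE mulNr. Qed.

Lemma dotBl n (v w x : 'rV['F_2]_n) : dot (v - w) x = dot v x - dot w x.
Proof. by rewrite dotDl dotNl. Qed.

Lemma dotZl n a (v x : 'rV['F_2]_n) : dot (a *: v) x = a * dot v x.
Proof. by rewrite mulr_sumr; apply: eq_bigr => i _; rewrite mxE mulrA. Qed.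

Lemma dot_suml n (I : finType) (v : I -> 'rV['F_2]_n) x :
  dot (\sum_i v i) x = \sum_i dot (v i) x.
Proof. by rewrite (big_morph (fun v => dot v x) (fun v w => dotDl v w x) (dot0l x)). Qed.

Lemma dotDr n (v x y : 'rV['F_2]_n) : dot v (x + y) = dot v x + dot v y.
Proof. by rewrite -big_split; apply: eq_bigr => i _; rewrite mxE mulrDr. Qed.

Lemma dot_delta n (v : 'rV['F_2]_n) i : dot v (delta_mx 0 i) = v 0 i.
Proof.
rewrite /dot (bigD1 i) //= big1 => [|j /negPf ji].
  by rewrite mxE !eqxx mulr1 addr0.
by rewrite mxE ji andbF mulr0.
Qed.

Lemma dot_row_mx n p (v : 'rV['F_2]_n) (w : 'rV_p) x y :
  dot (row_mx v w) (row_mx x y) = dot v x + dot w y.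
Proof.
rewrite /dot big_split_ord; congr (_ + _); apply: eq_bigr => i _.
  by rewrite !row_mxEl.
by rewrite !row_mxEr.
Qed.

Lemma sum_rV_row_mx n p (G : 'rV['F_2]_(n + p) -> int) :
  \sum_z G z = \sum_y \sum_x G (row_mx y x).
Proof.
rewrite pair_big /=.
rewrite (reindex (fun q : 'rV['F_2]_n * 'rV['F_2]_p => row_mx q.1 q.2)) //=.
exists (fun z => (lsubmx z, rsubmx z)) => [[y x] _|z _] /=.
  by rewrite row_mxKl row_mxKr.
by rewrite hsubmxK.
Qed.

(** Orthogonality of characters: if [v] is nonzero at [i], translating [x] by the [i]-th unit vector
    flips every sign, so the sum equals its own opposite. *)
Lemma sum_sign_dot n (v : 'rV['F_2]_n) :
  \sum_(x : 'rV['F_2]_n) (-1) ^+ nat_of_ord (dot v x)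
    = (if v == 0 then 2 ^+ n else 0)%R :> int.
Proof.
case: eqP => [->|/eqP v_neq0].
  rewrite (eq_bigr (fun=> 1)) => [|x _]; last by rewrite dot0l.
  by rewrite sumr_const card_mx card_Fp // mul1n natrX.
have /existsP[i vi] : [exists i, v 0 i != 0].
  apply: contraNT v_neq0 => /existsPn v0; apply/eqP/rowP => i.
  by rewrite mxE; apply/eqP; move/negbNE: (v0 i).
set S := \sum_x _.
have SN : S = - S.
  rewrite {1}/S (reindex_inj (addIr (delta_mx 0 i))) -sumrN.
  apply: eq_bigr => x _.
  by rewrite dotDr dot_delta (nonzeroF2 vi) signF2D mulrN1.
by move/eqP: SN; rewrite -addr_eq0 -mulr2n Num.Theory.mulrn_eq0 => /eqP.
Qed.

(** * Binary expansions and the integers [y] *)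

Lemma binary_digits_inj n (a b : 'I_n -> bool) :
  (\sum_(j < n) a j * 2 ^ j = \sum_(j < n) b j * 2 ^ j)%N -> a =1 b.
Proof.
elim: n a b => [|n IHn] a b; first by move=> _ [].
have tailE (c : 'I_n.+1 -> bool) : (\sum_(j < n.+1) c j * 2 ^ j
    = c ord0 + (\sum_(j < n) c (lift ord0 j) * 2 ^ j).*2)%N.
  rewrite big_ord_recl muln1 -muln2 big_distrl; congr addn.
  by apply: eq_bigr => j _; rewrite expnSr mulnA.
rewrite !tailE => E.
(* Parity isolates the lowest digit, since the other digits contribute an even number. *)
have ab0 : a ord0 = b ord0.
  by move/(congr1 odd): E; rewrite !oddD !odd_double !addbF !oddb.
move: E; rewrite ab0 => /addnI/double_inj/IHn ab j.
by case: (unliftP ord0 j) => [i|] -> //; apply: ab.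
Qed.

Lemma binary_digits_lt n (a : 'I_n -> bool) : (\sum_(j < n) a j * 2 ^ j < 2 ^ n)%N.
Proof.
elim: n a => [|n IHn] a; first by rewrite big_ord0.
rewrite big_ord_recr /= expnS mul2n -addnn -ltnS -addSn.
apply: leq_add (IHn _) _.
by case: (a _); rewrite ?mul1n ?mul0n.
Qed.

Lemma intvalE k (y : 'rV['F_2]_k) :
  intval y = (\sum_(j < k) (y ord0 j != 0%R) * 2 ^ j)%N.
Proof. by apply: eq_bigr => j _; case: (y ord0 j) => [[|[|]]]. Qed.

Lemma intval_inj k : injective (@intval k).
Proof.
move=> y z; rewrite !intvalE => /binary_digits_inj yz.
apply/rowP => j; have := yz j.
by case: (eqVneq (y 0 j) 0) (eqVneq (z 0 j) 0)
  => [->|/nonzeroF2->] [->|/nonzeroF2->].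
Qed.

Lemma intval_lt k (y : 'rV['F_2]_k) : (intval y < 2 ^ k)%N.
Proof. by rewrite intvalE binary_digits_lt. Qed.

Lemma intval_gt0 k (y : 'rV['F_2]_k) : y != 0 -> (0 < intval y)%N.
Proof.
rewrite lt0n; apply: contra => /eqP y0; apply/eqP/intval_inj.
by rewrite y0 /intval big1 // => j _; rewrite mxE.
Qed.

(** * Linear independence of the powers of gamma *)

Lemma prim_root_neq0 (K : fieldType) n (z : K) : n.-primitive_root z -> z != 0.
Proof.
by move=> z_prim; rewrite (prim_root_eq0 z_prim) -lt0n (prim_order_gt0 z_prim).
Qed.

(** Coordinates in a basis of [V] embed it into the row vectors over [K]. Elements are counted by a
    duplicate-free list because [vT] is not a finite type. *)
Lemma uniq_vspace_size (K : finFieldType) (vT : vectType K) (V : {vspace vT})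
  (s : seq vT) : uniq s -> {subset s <= V} -> (size s <= #|K| ^ \dim V)%N.
Proof.
move=> s_uniq sV; pose coords v := \row_i coord (vbasis V) i v.
have coords_inj : {in s &, injective coords}.
  move=> x y /sV/coord_vbasis{2}-> /sV/coord_vbasis{2}-> /rowP xy.
  by apply: eq_bigr => i _; have := xy i; rewrite !mxE => ->.
rewrite -[\dim V]mul1n -card_mx -(size_map coords).
by rewrite -(card_uniqP _) ?max_card ?map_inj_in_uniq.
Qed.

(** Zero and the 2^k - 1 distinct powers of [gamma] all lie in F_2(gamma), which therefore has
    dimension at least k. *)
Lemma adjoin_degree_primitive (F : fieldExtType 'F_2) (gamma : F) k :
  (0 < k)%N -> (2 ^ k - 1)%N.-primitive_root gamma ->
  (k <= adjoin_degree 1%AS gamma)%N.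
Proof.
move=> k_gt0 gamma_prim.
have dimE : \dim <<1; gamma>> = adjoin_degree 1%AS gamma.
  by rewrite dim_Fadjoin dimv1 muln1.
rewrite -dimE -(leq_exp2l (m := 2)) // -{2}(@card_Fp 2) //.
pose s := 0 :: [seq gamma ^+ i | i <- iota 0 (2 ^ k - 1)].
have <- : size s = (2 ^ k)%N.
  by rewrite /= size_map size_iota subn1 prednK // expn_gt0.
have gamma_neq0 i : gamma ^+ i != 0.
  exact/expf_neq0/(prim_root_neq0 gamma_prim).
apply: uniq_vspace_size.
  rewrite /= map_inj_in_uniq ?iota_uniq ?andbT => [|i j].
    by apply/mapP => -[i _ /eqP]; rewrite eq_sym (negPf (gamma_neq0 i)).
  rewrite !mem_iota /= !add0n => ltin ltjn /eqP.
  by rewrite (eq_prim_root_expr gamma_prim) !modn_small // => /eqP.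
move=> x; rewrite inE => /predU1P[->|/mapP[i _ ->]]; first exact: mem0v.
exact/rpredX/memv_adjoin.
Qed.

(** The [c i] are the coefficients of a polynomial over F_2 that vanishes at [gamma] and has degree
    below that of the minimal polynomial, so it is zero. *)
Lemma sum_powers_eq0 (F : fieldExtType 'F_2) (gamma : F) k (c : 'I_k -> 'F_2) :
    (k <= adjoin_degree 1%AS gamma)%N ->
  \sum_(i < k) c i *: gamma ^+ i = 0 -> forall i, c i = 0.
Proof.
move=> lek sum0.
pose p : {poly F} := \poly_(i < k) (if insub i is Some j then (c j)%:A else 0).
have p_over : p \is a polyOver 1%AS.
  apply/polyOver_poly => i _; case: insub => [j|]; last exact: rpred0.
  exact/rpredZ/rpred1.
have p_coef (i : 'I_k) : p`_i = (c i)%:A.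
  by rewrite coef_poly ltn_ord insubT //= => ?; congr (c _)%:A; apply/val_inj.
have p0 : p = 0.
  apply/eqP; rewrite -(root_small_adjoin_poly p_over (leq_trans (size_poly _ _) lek)).
  rewrite rootE (horner_coef_wide _ (size_poly _ _)) -[X in _ == X]sum0; apply/eqP.
  by apply: eq_bigr => i _; rewrite p_coef mulr_algl.
move=> i; apply/eqP; have := p_coef i.
by rewrite p0 coef0 => /esym/eqP; rewrite scaler_eq0 oner_eq0 orbF.
Qed.

(** * Injectivity of pi and of the combinations of the phi_i *)

Lemma pi_inj (F : fieldExtType 'F_2) (gamma : F) k :
  (0 < k)%N -> \dim {:F} = k -> (2 ^ k - 1)%N.-primitive_root gamma ->
  injective (pi_ gamma k).
Proof.
move=> k_gt0 dimF gamma_prim x y /rowP xy.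
have X_basis : basis_of {:F} [tuple gamma ^+ i | i < k].
  rewrite basisEfree subvf size_tuple dimF leqnn !andbT.
  apply/freeP => c c0; apply: (sum_powers_eq0 (gamma := gamma)).
    exact: adjoin_degree_primitive.
  by rewrite -[RHS]c0; apply: eq_bigr => i _; rewrite -tnth_nth tnth_mktuple.
rewrite (coord_basis X_basis (memvf x)) (coord_basis X_basis (memvf y)).
by apply: eq_bigr => i _; have := xy i; rewrite !mxE => ->.
Qed.

Lemma pi_sum (F : fieldExtType 'F_2) (gamma : F) k (c : 'rV['F_2]_k) (z : 'I_k -> F) :
  pi_ gamma k (\sum_i c 0 i *: z i) = \sum_i c 0 i *: pi_ gamma k (z i).
Proof.
apply/rowP => j; rewrite mxE linear_sum summxE; apply: eq_bigr => i _.
by rewrite !mxE linearZ.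
Qed.

(** For fixed y, f_c is the linear form in x given by this vector padded with two zeros: f_c is of
    Maiorana-McFarland type. *)
Definition phi_comb (F : fieldExtType 'F_2) (gamma : F) k (c y : 'rV['F_2]_k) :=
  \sum_(i < k) c 0 i *: phi gamma i y.

Lemma phi_comb_inj (F : fieldExtType 'F_2) (gamma : F) k (c : 'rV['F_2]_k) :
    (0 < k)%N -> \dim {:F} = k -> (2 ^ k - 1)%N.-primitive_root gamma ->
  c != 0 -> injective (phi_comb gamma c).
Proof.
move=> k_gt0 dimF gamma_prim c_neq0.
(* [phi] uses the exponent [y] + i + 1 with i counted from 0, so gamma^([y] + 1) factors out and
   leaves [u]. *)
pose u := \sum_(i < k) c 0 i *: gamma ^+ i.
have gamma_neq0 := prim_root_neq0 gamma_prim.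
have u_neq0 : u != 0.
  apply: contra c_neq0 => /eqP u0; apply/eqP/rowP => i; rewrite mxE.
  exact: (sum_powers_eq0 (adjoin_degree_primitive k_gt0 gamma_prim) u0).
have phi_combE y : phi_comb gamma c y
    = pi_ gamma k (if y == 0 then 0 else gamma ^+ (intval y).+1 * u).
  transitivity (pi_ gamma k (\sum_i c 0 i *:
      (if y == 0 then 0 else gamma ^+ (intval y + i.+1)))).
    rewrite pi_sum; apply: eq_bigr => i _; rewrite /phi; case: eqP => // _.
    by congr (_ *: _); apply/rowP => j; rewrite !mxE linear0.
  congr (pi_ _ _ _); case: eqP => _; first by rewrite big1 // => i _; rewrite scaler0.
  rewrite mulr_sumr; apply: eq_bigr => i _.
  by rewrite -scalerAr -exprD addnS addSn.
move=> y z; rewrite !phi_combE => /(pi_inj k_gt0 dimF gamma_prim).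
have nz n : gamma ^+ n * u != 0 by rewrite mulf_neq0 // expf_neq0.
have [->|y_neq0] := eqVneq y 0; have [->|z_neq0] := eqVneq z 0 => //.
- by move/eqP; rewrite eq_sym (negPf (nz _)).
- by move/eqP; rewrite (negPf (nz _)).
move/(mulIf u_neq0)/eqP; rewrite (eq_prim_root_expr gamma_prim) => eq_yz.
apply: intval_inj.
(* Shifted to start from 0, the integers [v] lie below the order of gamma, so congruent exponents
   are equal. *)
have bound (v : 'rV_k) : v != 0 -> ((intval v).-1 < 2 ^ k - 1)%N.
  by move/intval_gt0 => v_gt0; rewrite ltn_subRL add1n prednK // intval_lt.
move: eq_yz; rewrite -(prednK (intval_gt0 y_neq0)) -(prednK (intval_gt0 z_neq0)).
rewrite -addn2 -[in X in _ == X %[mod _]]addn2 eqn_modDr !modn_small ?bound //.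
by move/eqP->.
Qed.

Lemma conform_castmx_id (R : Type) m n p (e : n = p) (A : 'M[R]_(m, p)) (B : 'M_(m, n)) :
  conform_mx A B = castmx (erefl m, e) B.
Proof. by case: p / e A => A; rewrite conform_mx_id. Qed.

Lemma castmxB (V : zmodType) m n p (e : n = p) (A B : 'M[V]_(m, n)) :
  castmx (erefl m, e) A - castmx (erefl m, e) B = castmx (erefl m, e) (A - B).
Proof. by case: p / e. Qed.

(** * Walsh transforms of the f_c and inner products of the sequences *)

Section Sequences.

Variables (F : fieldExtType 'F_2) (gamma : F) (k : nat).
Hypotheses (k_gt0 : (0 < k)%N) (dimF : \dim {:F} = k).
Hypothesis gamma_prim : (2 ^ k - 1)%N.-primitive_root gamma.

Implicit Types (c e : 'rV['F_2]_k) (w : 'rV['F_2]_(nvars k)).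

Local Notation fc := (@fcomb F gamma k).

Definition last2 w : 'rV['F_2]_2 := rsubmx (rsubmx (w : 'rV_(k + (k + 2)))).

Lemma fcomb_row_mx c (y : 'rV_k) (x : 'rV_(k + 2)) :
  fc c (row_mx y x) = dot (row_mx (phi_comb gamma c y) 0) x.
Proof.
rewrite ffunE -(hsubmxK x) dot_row_mx dot0l addr0 dot_suml; apply: eq_bigr => i _.
by rewrite ffunE row_mxKl row_mxKr dot_row_mx dot0l addr0 dotZl.
Qed.

Lemma fcombB c e z : fc (c - e) z = fc c z - fc e z.
Proof.
by rewrite !ffunE -sumrB; apply: eq_bigr => i _; rewrite !mxE mulrBl.
Qed.

(** For fixed y the sum over x is a character sum, evaluated by [sum_sign_dot]. *)
Lemma walsh_fcomb c w :
  walsh (fc c) w = \sum_(y : 'rV_k)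
    (-1) ^+ nat_of_ord (dot (lsubmx (w : 'rV_(k + (k + 2)))) y) *
    (if row_mx (phi_comb gamma c y) 0 + rsubmx (w : 'rV_(k + (k + 2))) == 0
     then 2 ^+ (k + 2) else 0).
Proof.
rewrite /walsh sum_rV_row_mx; apply: eq_bigr => y _.
rewrite -sum_sign_dot mulr_sumr; apply: eq_bigr => x _.
by rewrite fcomb_row_mx -{1}(hsubmxK w) dot_row_mx addrCA signF2D dotDl.
Qed.

Lemma walsh_fcomb0 w : walsh (fc 0) w = if w == 0 then 2 ^+ nvars k else 0.
Proof.
rewrite -sum_sign_dot; apply: eq_bigr => z _.
by rewrite ffunE big1 ?add0r // => i _; rewrite mxE mul0r.
Qed.

(** An injective self-map of a finite set is bijective, so at most one y contributes, and one does
    exactly when the two padding coordinates match; [b] records its sign. *)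
Lemma walsh_fcomb_neq0 c w : c != 0 -> exists b : bool,
  walsh (fc c) w = if last2 w == 0 then (-1) ^+ b * 2 ^+ (k + 2) else 0.
Proof.
move=> c_neq0; have phi_comb_bij := injF_bij (phi_comb_inj k_gt0 dimF gamma_prim c_neq0).
set a := rsubmx (w : 'rV_(k + (k + 2))).
have eq0E y : (row_mx (phi_comb gamma c y) 0 + a == 0) =
    (phi_comb gamma c y == - lsubmx a) && (last2 w == 0).
  rewrite -(hsubmxK a) add_row_mx add0r row_mxKl -[0 in LHS]row_mx0.
  rewrite -[_ == - _]subr_eq0 opprK.
  apply/eqP/andP => [/eq_row_mx[-> last0]|[/eqP-> /eqP last0]].
    by rewrite /last2 -/a last0.
  by rewrite -last0.
have [g fK gK] := phi_comb_bij.
exists (nat_of_ord (dot (lsubmx (w : 'rV_(k + (k + 2)))) (g (- lsubmx a))) != 0%N).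
rewrite walsh_fcomb (bigD1 (g (- lsubmx a))) //= big1 => [|y y_neq].
  rewrite -/a eq0E gK eqxx addr0; case: eqP => _; last by rewrite mulr0.
  by congr (_ * _); case: (dot _ _) => [[|[|]]].
by rewrite -/a eq0E (can2_eq fK gK) (negPf y_neq) mulr0.
Qed.

(** Common form of the members of all S_{c,alpha}; an arbitrary [w] replaces the concatenation, so
    that differences stay in the family. *)
Definition affine_seq c w : intseq (nvars k) :=
  seq_of [ffun z => fc c z + dot w z].

Lemma affine_seqE c w z :
  affine_seq c w z = (-1) ^+ nat_of_ord (fc c z + dot w z).
Proof. by rewrite !ffunE. Qed.

(** f_c is additive in c and the linear part in w, so orthogonality becomes the vanishing of a Walsh
    value. *)
Lemma sum_affine_seqM c e w w' :
  \sum_z seq_mul (affine_seq c w) (affine_seq e w') z = walsh (fc (c - e)) (w - w').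
Proof.
apply: eq_bigr => z _; rewrite [LHS]ffunE !affine_seqE fcombB dotBl.
by rewrite [in RHS]addrACA -opprD [RHS]signF2D signF2N.
Qed.

(** Equal sequences have inner product 2^m. For c != e it has absolute value at most 2^(k+2), which
    is smaller because k > 0. *)
Lemma affine_seq_inj c e w w' :
  affine_seq c w = affine_seq e w' -> c = e /\ w = w'.
Proof.
move=> eq_cw; have := sum_affine_seqM c c w w.
rewrite {2}eq_cw sum_affine_seqM !subrr walsh_fcomb0 eqxx.
have [/eqP|ce_neq0] := eqVneq (c - e) 0.
  rewrite subr_eq0 => /eqP->; rewrite subrr walsh_fcomb0 subr_eq0.
  by case: eqP => // _ /eqP; rewrite eq_sym expf_eq0 andbF.
have [b ->] := walsh_fcomb_neq0 (w - w') ce_neq0.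
case: eqP => _ /(congr1 absz); rewrite ?abszM !abszX ?exp1n ?mul1n => /eqP.
  by rewrite eqn_exp2l // ltn_eqF // -[X in (X < _)%N]add0n ltn_add2r.
by rewrite eq_sym expn_eq0.
Qed.

Lemma SsetP d c (alpha : 'rV['F_2]_d) s :
  reflect (exists beta, s = affine_seq c (concat beta alpha)) (s \in Sset gamma c alpha).
Proof.
have seqE beta : seq_mul (seq_of (fc c)) (seq_of (linf beta alpha))
    = affine_seq c (concat beta alpha).
  by apply/ffunP => z; rewrite affine_seqE signF2D !ffunE.
apply: (iffP (imfsetP _ _ _ _)) => [[l /imsetP[beta _ ->] ->]|[beta ->]].
  by exists beta.
exists (linf beta alpha); first exact: imset_f.
by rewrite seqE.
Qed.

Lemma perpP d c e (alpha delta : 'rV['F_2]_d) :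
  reflect (forall beta beta', walsh (fc (c - e))
             (concat beta alpha - concat beta' delta) = 0)
    (perp (Sset gamma c alpha) (Sset gamma e delta)).
Proof.
apply: (iffP forallP) => [orth beta beta'|walsh0 [s sS]].
  have sS : affine_seq c (concat beta alpha) \in Sset gamma c alpha.
    by apply/SsetP; exists beta.
  have tS : affine_seq e (concat beta' delta) \in Sset gamma e delta.
    by apply/SsetP; exists beta'.
  have /forallP/(_ [` tS])/eqP := orth [` sS].
  by rewrite sum_affine_seqM.
apply/forallP => -[t tS] /=; have /SsetP[beta ->] := sS.
by have /SsetP[beta' ->] := tS; rewrite /orthogonal_seq sum_affine_seqM walsh0.
Qed.

(** Adding a linear form only translates the Walsh transform. For c = 0 the value 2^m, with m > k +
    2, would occur. *)
Lemma affine_seq_semibent c w : c != 0 -> semibent_seq (affine_seq c w).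
Proof.
move=> c_neq0; exists [ffun z => fc c z + dot w z] => // lambda w'.
have -> : walsh [ffun z => fc c z + dot w z] w' = walsh (fc c) (w + w').
  by apply: eq_bigr => z _; rewrite ffunE dotDl addrA.
have [b ->] := walsh_fcomb_neq0 (w + w') c_neq0.
have -> : lambda = (k + 2)%N.
  by rewrite /lambda /nvars addnAC addnn -muln2 mulnK.
case: eqP => _; rewrite !inE ?eqxx //.
by case: b; rewrite ?mul1r ?mulN1r eqxx !orbT.
Qed.


Lemma mem_Sset_semibent d c (alpha : 'rV['F_2]_d) s :
  c != 0 -> s \in Sset gamma c alpha -> semibent_seq s.
Proof. by move=> c_neq0 /SsetP[beta ->]; apply: affine_seq_semibent. Qed.

(** * The sets S_{c,alpha}: orthogonality, cardinality and distinctness *)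

Section Concatenation.

Variable d : nat.
Hypothesis le_d : (d <= nvars k)%N.
Implicit Types (alpha delta : 'rV['F_2]_d).

Lemma concatE (beta : 'rV['F_2]_(nvars k - d)) alpha :
  concat beta alpha = castmx (erefl 1%N, subnK le_d) (row_mx beta alpha).
Proof. exact: conform_castmx_id. Qed.

Lemma concatB (beta beta' : 'rV['F_2]_(nvars k - d)) alpha delta :
  concat beta alpha - concat beta' delta = concat (beta - beta') (alpha - delta).
Proof. by rewrite !concatE castmxB opp_row_mx add_row_mx. Qed.

Lemma concat_inj (beta beta' : 'rV['F_2]_(nvars k - d)) alpha delta :
  concat beta alpha = concat beta' delta -> beta = beta' /\ alpha = delta.
Proof. by rewrite !concatE => /(can_inj (castmxK _ _))/eq_row_mx. Qed.

Lemma concat_entry (beta : 'rV['F_2]_(nvars k - d)) alpha (i : 'I_(nvars k)) (j : 'I_d) :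
  i = (nvars k - d + j)%N :> nat -> concat beta alpha 0 i = alpha 0 j.
Proof.
move=> ij; rewrite concatE castmxE /= cast_ord_id.
by have -> : cast_ord (esym (subnK le_d)) i = rshift _ j
  by [apply: val_inj]; rewrite row_mxEr.
Qed.

(** The inner product is nonzero only when the linear parts coincide; [beta] = [beta'] achieves this
    if [alpha] = [delta], and nothing does otherwise. *)
Lemma perp_same e alpha delta :
  perp (Sset gamma e alpha) (Sset gamma e delta) = (alpha != delta).
Proof.
apply/perpP/idP => [/(_ 0 0)|neq beta beta']; rewrite subrr walsh_fcomb0 subr_eq0.
  case: eqP => [_ /eqP|]; first by rewrite expf_eq0 andbF.
  by move=> ne _; apply: contra_not_neq ne => ->.
by case: eqP => // /concat_inj[_ /eqP]; rewrite (negPf neq).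
Qed.

Lemma Sset_orthogonal c alpha : orthogonal_set (Sset gamma c alpha).
Proof.
move=> s t /SsetP[beta ->] /SsetP[beta' ->] neq.
rewrite /orthogonal_seq sum_affine_seqM subrr walsh_fcomb0 subr_eq0.
by rewrite ifN //; apply: contra_neq neq => ->.
Qed.

Lemma card_Sset c alpha : #|` Sset gamma c alpha| = (2 ^ (nvars k - d))%N.
Proof.
have -> : Sset gamma c alpha
    = [fset affine_seq c (concat beta alpha) | beta in 'rV['F_2]_(nvars k - d)].
  apply/fsetP => s; apply/SsetP/imfsetP => [[beta ->]|[beta _ ->]];
  by exists beta.
rewrite card_imfset /=; first by rewrite -cardE card_mx card_Fp // mul1n.
by move=> beta beta' /affine_seq_inj[_ /concat_inj[]].
Qed.

Lemma Sset_inj c e alpha delta :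
  Sset gamma c alpha = Sset gamma e delta -> c = e /\ alpha = delta.
Proof.
move=> /fsetP/(_ (affine_seq c (concat 0 alpha))).
have -> : affine_seq c (concat 0 alpha) \in Sset gamma c alpha.
  by apply/SsetP; exists 0.
by move=> /esym/SsetP[beta /affine_seq_inj[-> /concat_inj[_ ->]]].
Qed.

(** By [Sset_inj] distinct pairs index distinct sets, so counting sets reduces to counting pairs. *)
Lemma card_Omega_perp e delta :
  #|` [fset X in Omega gamma k d | perp X (Sset gamma e delta)]|
    = #|[set p : 'rV['F_2]_k * 'rV['F_2]_d |
          perp (Sset gamma p.1 p.2) (Sset gamma e delta)]|.
Proof.
set P := [set p | _].
have -> : [fset X in Omega gamma k d | perp X (Sset gamma e delta)]
    = [fset Sset gamma p.1 p.2 | p in P].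
  apply/fsetP => X; rewrite !inE /=.
  apply/andP/imfsetP => /= [[/imfsetP[p _ ->] perpX]|[p]].
    by exists p; rewrite ?inE.
  by rewrite inE => perpX ->; split=> //; apply/imfsetP; exists p.
rewrite card_imfset /=; first by rewrite -cardE.
by move=> [c alpha] [c' alpha'] /= /Sset_inj[-> ->].
Qed.

End Concatenation.

(** * The last two coordinates, with d = n + 2, and the count of orthogonal sets *)

Variable n : nat.
Hypothesis le_n2 : (n + 2 <= nvars k)%N.
Implicit Types (alpha delta : 'rV['F_2]_(n + 2)).

Lemma last2_concat (beta : 'rV['F_2]_(nvars k - (n + 2))) alpha :
  last2 (concat beta alpha) = rsubmx alpha.
Proof.
apply/rowP => j; rewrite !mxE; apply: (concat_entry le_n2) => /=.
by move: le_n2; rewrite /nvars; lia.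
Qed.

(** The Walsh value at a difference vanishes or not according to its last two coordinates, which do
    not depend on [beta] and [beta']. *)
Lemma perp_diff c e alpha delta : e != c ->
  perp (Sset gamma c alpha) (Sset gamma e delta) = (rsubmx alpha != rsubmx delta).
Proof.
move=> ec; have ce : c - e != 0 by rewrite subr_eq0 eq_sym.
have last2E beta beta' :
    (last2 (concat beta alpha - concat beta' delta) == 0) = (rsubmx alpha == rsubmx delta).
  by rewrite (concatB le_n2) last2_concat linearB subr_eq0.
apply/perpP/idP => [/(_ 0 0)|neq beta beta'].
  have [b ->] := walsh_fcomb_neq0 (concat 0 alpha - concat 0 delta) ce.
  rewrite last2E; case: eqP => // _ /eqP.
  by rewrite mulf_eq0 !expf_eq0 !andbF.
have [b ->] := walsh_fcomb_neq0 (concat beta alpha - concat beta' delta) ce.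
by rewrite last2E (negPf neq).
Qed.

Lemma card_perp_pairs e delta :
  #|[set p : 'rV['F_2]_k * 'rV['F_2]_(n + 2) |
      perp (Sset gamma p.1 p.2) (Sset gamma e delta)]|
    = (3 * 2 ^ (k + n) + 2 ^ n - 1)%N.
Proof.
pose A : {set 'rV['F_2]_(n + 2)} := [set alpha | rsubmx alpha == rsubmx delta].
have cardA : #|A| = (2 ^ n)%N.
  have -> : A = [set row_mx a (rsubmx delta) | a : 'rV_n].
    apply/setP => alpha; rewrite inE.
    apply/eqP/imsetP => [<-|[a _ ->]]; last by rewrite row_mxKr.
    by exists (lsubmx alpha); rewrite ?hsubmxK.
  rewrite card_imset; first by rewrite cardE -cardT card_mx card_Fp // mul1n.
  by move=> a a' /eq_row_mx[].
(* Pairs with c != e need [alpha] outside [A]; those with c = e need only [alpha] != [delta]. *)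
have -> : [set p : 'rV['F_2]_k * 'rV['F_2]_(n + 2) |
    perp (Sset gamma p.1 p.2) (Sset gamma e delta)]
    = setX [set~ e] (~: A) :|: setX [set e] [set~ delta].
  apply/setP => -[c alpha]; rewrite !inE /=.
  have [->|ce] := eqVneq c e; first by rewrite (perp_same le_n2).
  by rewrite orbF perp_diff // eq_sym.
rewrite cardsU disjoint_setI0 ?cards0 ?subn0; last first.
  rewrite -setI_eq0; apply/eqP/setP => -[c alpha]; rewrite !inE /=.
  by case: (c == e); rewrite ?andbF.
rewrite !cardsX !cardsC1 cardsCs setCK cardA cards1 !card_mx !card_Fp //.
(* The count is (2^k - 1)(2^(n+2) - 2^n) + 2^(n+2) - 1; positivity of the powers controls the
   truncated subtractions. *)
rewrite !mul1n !expnD; have := expn_gt0 2 n; have := expn_gt0 2 k => /=.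
by nia.
Qed.

Lemma entry_ord p (v : 'rV['F_2]_p) (i : 'I_p) : entry v i.+1 = v 0 i.
Proof. by rewrite /entry /= valK. Qed.

Lemma rsubmx_eqP alpha delta :
  reflect ((entry alpha (n + 2 - 1), entry alpha (n + 2))
             = (entry delta (n + 2 - 1), entry delta (n + 2)))
          (rsubmx alpha == rsubmx delta).
Proof.
(* [entry] counts from 1, so positions d - 1 and d are indices 0 and 1 of the right block. *)
have e0 v : entry v (n + 2 - 1) = rsubmx (v : 'rV['F_2]_(n + 2)) 0 0.
  by rewrite mxE -entry_ord; congr entry; rewrite -addnBA //= addn0 addn1.
have e1 v : entry v (n + 2) = rsubmx (v : 'rV['F_2]_(n + 2)) 0 1.
  by rewrite mxE -entry_ord; congr entry; rewrite /= addn1 addn2.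
rewrite !e0 !e1; apply: (iffP eqP) => [-> //|[eq0 eq1]].
(* The index type ['I_2] is read as ['F_2], whose elements are 0 and 1. *)
by apply/rowP => j; have [->|/nonzeroF2->] := eqVneq (j : 'F_2) 0.
Qed.

End Sequences.

Theorem theorem3 (k m d : nat) (F : fieldExtType 'F_2) (gamma : F)
    (k_gt0 : (0 < k)%N) (m_def : m = (2 * k + 2)%N) (d_def : d = 2%N \/ d = 3%N)
    (dimF : \dim {:F} = k)
    (gamma_prim : (2 ^ k - 1)%N.-primitive_root gamma) :
  [/\ (* (i) *)
      forall (c : 'rV['F_2]_k) (alpha : 'rV['F_2]_d), c != 0 ->
        forall s, s \in Sset gamma c alpha -> semibent_seq s,
      (* (ii) *)
      forall (c : 'rV['F_2]_k) (alpha : 'rV['F_2]_d),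
        orthogonal_set (Sset gamma c alpha) /\
        #|` Sset gamma c alpha| = (2 ^ (m - d))%N,
      (* (iii) *)
      (forall (c : 'rV['F_2]_k) (alpha : 'rV['F_2]_d)
              (e : 'rV['F_2]_k) (delta : 'rV['F_2]_d), e != c ->
        (perp (Sset gamma c alpha) (Sset gamma e delta) <->
         (entry alpha (d - 1), entry alpha d)
           <> (entry delta (d - 1), entry delta d))) /\
      (forall (e : 'rV['F_2]_k) (alpha delta : 'rV['F_2]_d),
        perp (Sset gamma e alpha) (Sset gamma e delta) <-> alpha <> delta)
    & (* (iv) *)
      forall (e : 'rV['F_2]_k) (delta : 'rV['F_2]_d),
        #|` [fset X in Omega gamma k d | perp X (Sset gamma e delta)]|
          = (3 * 2 ^ (k + d - 2) + 2 ^ (d - 2) - 1)%N].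
Proof.
have [n d_eq le_n2] : exists2 n, d = (n + 2)%N & (n + 2 <= nvars k)%N.
  case: d_def => ->; [exists 0%N | exists 1%N] => //; rewrite /nvars; lia.
subst d; have -> : m = nvars k by rewrite /nvars; lia.
split.
- by move=> c alpha c_neq0 s; apply: mem_Sset_semibent.
- by move=> c alpha; split; [apply: Sset_orthogonal|apply: card_Sset].
- split=> [c alpha e delta ec|e alpha delta].
    rewrite (perp_diff k_gt0 dimF gamma_prim le_n2) //.
    by split=> [/rsubmx_eqP|/rsubmx_eqP].
  by rewrite (perp_same gamma le_n2); split=> /eqP.
move=> e delta; rewrite card_Omega_perp // card_perp_pairs // addnA !addnK //.
Qed.
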